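(* Consider the usual pairwise order model (all $c_h=1$). For every even $m\ge 4$, the design $d^*$ with $N=m!/(m/2)!$ runs (constructed in the context) has moment matrix $M_0=\frac{1}{m!}\sum_{a\in A}x(a)x(a)^T$, i.e. the moment matrix of the uniform design measure on the set $A$ of all $m!$ permutations of $1,\ldots,m$; and hence $d^*$ is $\phi$-optimal, among designs with the same number of runs, for every optimality criterion $\phi(\cdot)$ which is concave and signed permutation invariant.
   Context: Model. $A$ is the set of all orderings (treatments) $a=a_1\ldots a_m$ of $1,\ldots,m$. $S$ is the set of all pairs $ij$ with $1\le i<j\le m$, listed in the order $12,13,\ldots,1m,23,\ldots,(m-1)m$. For $a\in A$, $ij\in S$, let $z_{ij}(a)=1$ if $i$ precedes $j$ in $a$ and $z_{ij}(a)=-1$ if $j$ precedes $i$ in $a$. Let $z(a)=(z_{ij}(a))_{ij\in S}$ (a $q\times 1$ column vector, $q=m(m-1)/2$), $x(a)=[1,z(a)^T]^T$ and $p=q+1$. Designs. An $N$-run (exact) design $d$ replicates each treatment $a\in A$ a nonnegative integer number $r(a)$ of times, with $\sum_{a\in A}r(a)=N$; its (per run) moment matrix is $\sum_{a\in A}\{r(a)/N\}x(a)x(a)^T$. Criteria. Let $\mathcal{M}$ be the class of $p\times p$ (symmetric) nonnegative definite matrices. An optimality criterion is a function $\phi$ on $\mathcal{M}$ with values in $\mathbb{R}\cup\{-\infty\}$. It is concave if concave over $\mathcal{M}$, and signed permutation invariant if $\phi(R^TMR)=\phi(M)$ for all $M\in\mathcal{M}$ and all signed permutation matrices $R$ of order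 $p$ (square matrices with exactly one nonzero entry in each row and column, each nonzero entry being $\pm1$). A design is $\phi$-optimal among $N$-run designs if its moment matrix maximizes $\phi$ over the moment matrices of all $N$-run designs. Construction of $d^*$. Let $m$ be even, $s=m/2$, $L=m!/\{2(s!\,s!)\}$, $\Gamma=\{1,\ldots,m\}$. Let $C_1,\ldots,C_L$ be the distinct subsets of $\Gamma$ (lexicographically arranged) consisting of $1$ and $s-1$ other elements of $\Gamma$, and let $\overline{C}_u$ be the complement of $C_u$ in $\Gamma$. For each $u$, $B_u$ is the $s!\times s$ array whose rows are all the permutations of the elements of $C_u$, and $\overline{B}_u$ is the $s!\times s$ array whose rows are all the permutations of the elements of $\overline{C}_u$ (rows listed in lexicographic order). Let $\sim$ denote the operator of column reversal: $\sim\overline{B}_u$ is obtained from $\overline{B}_u$ by reversing the order of its columns. Define the $2(s!)\times m$ array $$D_u=\begin{bmatrix}B_u&\overline{B}_u\\ \sim\overline{B}_u&B_u\end{bmatrix},\qquad u=1,\ldots,L.$$ Then $d^*$ is the design consisting of the $m!/s!$ treatments given by the rows of $D=[D_1^T\ \cdots\ D_L^T]^T$. *)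

(* Defs.v *)
From HB Require Import structures.
From mathcomp Require Import all_boot all_order all_algebra fingroup perm.
From mathcomp Require Import constructive_ereal reals.

Set Implicit Arguments.
Unset Strict Implicit.
Unset Printing Implicit Defensive.

Import Order.TTheory GRing.Theory Num.Theory.
Local Open Scope ring_scope.

(* The labels 1, ..., m are represented by the ordinals 0, ..., m - 1 of 'I_m.
   A treatment is a permutation a : 'S_m, where a k is the label standing in
   position k; hence (a^-1)%g i is the position of the label i. *)

Definition precedes (m : nat) (a : 'S_m) (i j : 'I_m) : bool :=
  ((a^-1)%g i < (a^-1)%g j)%N.

Definition pairs (m : nat) : seq ('I_m * 'I_m) :=
  [seq (i, j) | i : 'I_m <- enum 'I_m,
                j : 'I_m <- [seq j : 'I_m <- enum 'I_m | (i < j)%N]].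

Definition q (m : nat) : nat := size (pairs m).

Definition p (m : nat) : nat := (1 + q m)%N.

Lemma qE (m : nat) : q m = (m * m.-1)./2.
Proof.
have -> : q m = (\sum_(i < m) count (fun j => i < j)%N (iota 0 m))%N.
  rewrite /q /pairs size_allpairs_dep sumnE big_map big_enum /=.
  apply: eq_bigr => i _; rewrite size_filter -val_enum_ord count_map.
  exact: eq_count.
rewrite -bin2; elim: m => [|m IHm]; first by rewrite big_ord0.
have cS i : count (fun j => i < j)%N (iota 0 m.+1)
    = (count (fun j => i < j)%N (iota 0 m) + (i < m))%N.
  by rewrite -[in iota 0 m.+1]addn1 iotaD count_cat /= addn0.
rewrite binS bin1 -IHm; under eq_bigr => i _ do rewrite cS.
rewrite big_ord_recr /= ltnn addn0.
have -> : count (fun j => m < j)%N (iota 0 m) = 0%N.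
  apply/eqP; rewrite -leqn0 leqNgt -has_count; apply/hasPn => j.
  by rewrite mem_iota add0n => /andP[_ /ltnW]; rewrite -leqNgt.
rewrite addn0 big_split /=; congr addn.
under eq_bigr => i _ do rewrite ltn_ord.
by rewrite sum1_card card_ord.
Qed.

Definition zval (R : realType) (m : nat) (a : 'S_m) (ij : 'I_m * 'I_m) : R :=
  if precedes a ij.1 ij.2 then 1 else -1.

Definition z (R : realType) (m : nat) (a : 'S_m) : 'cV[R]_(q m) :=
  \col_k zval R a (tnth (in_tuple (pairs m)) k).

Definition x (R : realType) (m : nat) (a : 'S_m) : 'cV[R]_(p m) :=
  col_mx (const_mx 1 : 'cV[R]_1) (z R a).

(* A design is given by its replication numbers r a. *)
Definition is_design (m N : nat) (r : 'S_m -> nat) : Prop :=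
  (\sum_(a : 'S_m) r a)%N = N.

Definition moment (R : realType) (m N : nat) (r : 'S_m -> nat) : 'M[R]_(p m) :=
  \sum_(a : 'S_m) ((r a)%:R / N%:R) *: (x R a *m (x R a)^T).

Definition M0 (R : realType) (m : nat) : 'M[R]_(p m) :=
  (m`!%:R)^-1 *: \sum_(a : 'S_m) (x R a *m (x R a)^T).

Definition nnd (R : realType) (n : nat) (M : 'M[R]_n) : Prop :=
  M^T = M /\ forall v : 'cV[R]_n, 0 <= (v^T *m M *m v) 0 0.

Definition signed_perm_mx (R : realType) (n : nat) (P : 'M[R]_n) : Prop :=
  [/\ forall i, exists! j, P i j != 0,
      forall j, exists! i, P i j != 0 &
      forall i j, P i j != 0 -> P i j = 1 \/ P i j = -1].

(* A criterion is a function on the nonnegative definite matrices only: it is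
   represented by a total function whose values elsewhere are never used. *)
Definition criterion (R : realType) (n : nat) (phi : 'M[R]_n -> \bar R) : Prop :=
  forall M, nnd M -> phi M <> +oo%E.

Definition concave (R : realType) (n : nat) (phi : 'M[R]_n -> \bar R) : Prop :=
  forall (M1 M2 : 'M[R]_n) (t : R), nnd M1 -> nnd M2 -> 0 < t < 1 ->
    (t%:E * phi M1 + (1 - t)%:E * phi M2 <= phi (t *: M1 + (1 - t) *: M2)%R)%E.

Definition signed_perm_invariant (R : realType) (n : nat)
    (phi : 'M[R]_n -> \bar R) : Prop :=
  forall M P : 'M[R]_n, nnd M -> signed_perm_mx P -> phi (P^T *m M *m P) = phi M.

Definition optimal (R : realType) (m N : nat) (phi : 'M[R]_(p m) -> \bar R)
    (r : 'S_m -> nat) : Prop :=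
  is_design N r /\
  forall r' : 'S_m -> nat, is_design N r' ->
    (phi (moment R N r') <= phi (moment R N r))%E.

(* Arrays are sequences of rows; rows and subsets (the latter listed in
   increasing order) are sequences of labels, compared lexicographically. *)
Definition lexsort (m : nat) (l : seq (seq 'I_m)) : seq (seq 'I_m) :=
  sort (fun v w => ((v : seqlexi 'I_m) <= (w : seqlexi 'I_m))%O) l.

Definition perm_array (m : nat) (c : seq 'I_m) : seq (seq 'I_m) :=
  lexsort (permutations c).

Definition colrev (m : nat) (B : seq (seq 'I_m)) : seq (seq 'I_m) := map rev B.

Definition hcat (m : nat) (B B' : seq (seq 'I_m)) : seq (seq 'I_m) :=
  [seq bb.1 ++ bb.2 | bb <- zip B B'].

Definition half_subsets (m : nat) : seq (seq 'I_m) :=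
  lexsort [seq enum C | C : {set 'I_m} in
             [pred C : {set 'I_m} | [exists i in C, val i == 0%N]
                                    & #|C| == m./2]].

Definition block (m : nat) (c : seq 'I_m) : seq (seq 'I_m) :=
  let B := perm_array c in
  let Bbar := perm_array [seq i <- enum 'I_m | i \notin c] in
  hcat B Bbar ++ hcat (colrev Bbar) B.

Definition dstar_array (m : nat) : seq (seq 'I_m) :=
  flatten [seq block c | c <- half_subsets m].

Definition word (m : nat) (a : 'S_m) : seq 'I_m := [seq a k | k <- enum 'I_m].

Definition dstar (m : nat) : 'S_m -> nat :=
  fun a => count_mem (word a) (dstar_array m).

Arguments dstar m a : clear implicits.

(* Main.v *)
Require Import Defs.
From mathcomp Require Import all_boot all_order all_algebra fingroup perm.
From mathcomp Require Import constructive_ereal reals.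

(** The moment matrix of [dstar m] is that of the uniform measure because each
    block reproduces, in second moments, the full set of words it samples.
    Let s = m/2, fix a half set C containing the first label, and write b for a
    permutation of C and b' for one of its complement.  The words b b' and
    (reversed b') b, over all pairs (b, b') and all C, list every word of the m
    labels exactly once: the position of the first label decides which half of
    the word is C ([all_stackings_perm]).  The block of C uses only s! of the
    (s!)^2 pairs, each b and each b' occurring in exactly one of them.

    Compare now the two words built from one pair (b, b').  If i and j both lie
    in C, then z_ij depends on b only and is the same in the two words; in all
    other cases z_ij depends on b' only and changes sign between the two words:
    reversal does it when i and j both lie outside C, and the exchange of the
    halves when the pair is split ([zword_stack]).  So for the product of two
    coordinates of x, the sum over the two words vanishes or depends on one of
    b, b' alone ([stack_prod]).  A function of the form g b + h b' has the same
    mean over any perfect matching of the words b with the words b' as over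
    all pairs ([sum_zip_additive]); hence s! times the sum over the array is the
    sum over all words ([sum_dstar]), and no second moment has to be computed.

    For optimality, relabelling the treatments by a permutation h acts on x by a
    signed permutation matrix: a pair is sent to a pair, with a sign when its
    order is reversed ([relabel_signed_perm]).  The mean of the conjugates of
    any moment matrix M over all h is the uniform moment matrix M0
    ([mean_relabel]).  An invariant criterion takes the value phi M at all the
    conjugates, and concavity makes the set where phi >= phi M convex, so this
    set contains M0 ([le_phi_M0]). *)

Set Implicit Arguments.
Unset Strict Implicit.
Unset Printing Implicit Defensive.

Import Order.TTheory GRing.Theory Num.Theory.
Local Open Scope ring_scope.

(** * Treatments as words *)

Definition zword (R : realType) (m : nat) (w : seq 'I_m)
    (ij : 'I_m * 'I_m) : R :=
  if (index ij.1 w < index ij.2 w)%N then 1 else -1.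

Definition xword (R : realType) (m : nat) (w : seq 'I_m) : 'cV[R]_(p m) :=
  col_mx (const_mx 1 : 'cV[R]_1)
    (\col_k zword R w (tnth (in_tuple (pairs m)) k)).

Lemma index_of_word (m : nat) (a : 'S_m) (i : 'I_m) :
  index i (word a) = (a^-1)%g i :> nat.
Proof.
rewrite -{1}(permKV a i) (index_map (@perm_inj _ a)).
exact: index_enum_ord.
Qed.

Lemma x_of_word (R : realType) (m : nat) (a : 'S_m) : x R a = xword R (word a).
Proof.
congr col_mx; apply/matrixP => k j; rewrite !mxE /zval /zword /precedes.
by rewrite !index_of_word.
Qed.

Lemma mem_word (m : nat) (w : seq 'I_m) :
  (w \in codom (@word m)) = (w \in permutations (enum 'I_m)).
Proof.
rewrite mem_permutations; apply/codomP/idP => [[a ->]|pw].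
  apply: uniq_perm; rewrite ?enum_uniq //.
    by rewrite map_inj_uniq ?enum_uniq //; exact: perm_inj.
  move=> i; rewrite mem_enum; apply/mapP; exists ((a^-1)%g i).
    by rewrite mem_enum.
  by rewrite permKV.
have sw : size w = m by rewrite (perm_size pw) size_enum_ord.
have uw : uniq w by rewrite (perm_uniq pw) enum_uniq.
(* For m > 0 the k-th entry of w defines a permutation; [ord0] is only the
   default value of [nth]. *)
case: m w sw uw {pw} => [|m] w sw uw.
  by exists 1%g; rewrite /word (size0nil sw) (size0nil (size_enum_ord 0)).
have inj_nth : injective (fun k : 'I_m.+1 => nth ord0 w k).
  move=> i j /eqP; rewrite nth_uniq ?sw ?ltn_ord // => /eqP; exact: val_inj.
exists (perm inj_nth); rewrite /word (eq_map (permE inj_nth)).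
rewrite (map_comp (nth ord0 w) val) val_enum_ord.
by rewrite -[X in iota 0 X]sw [RHS]mkseq_nth.
Qed.

Lemma word_inj (m : nat) : injective (@word m).
Proof.
move=> a b eqw; apply/eqP; rewrite -(inj_eq (@invg_inj _)).
apply/eqP/permP => i.
by apply: val_inj; rewrite /= -!index_of_word eqw.
Qed.

Lemma codom_word (m : nat) :
  perm_eq (codom (@word m)) (permutations (enum 'I_m)).
Proof.
apply: uniq_perm; last exact: mem_word.
  by rewrite map_inj_uniq ?enum_uniq //; exact: word_inj.
exact: permutations_uniq.
Qed.

Lemma sum_word (V : nmodType) (m : nat) (F : seq 'I_m -> V) :
  \sum_(a : 'S_m) F (word a) = \sum_(w <- permutations (enum 'I_m)) F w.
Proof. by rewrite -(perm_big _ (codom_word m)) big_map big_enum. Qed.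

(** A row that is not the word of a treatment would count on the right only,
    whence the hypothesis on [D]. *)
Lemma sum_count_word (V : nmodType) (m : nat) (D : seq (seq 'I_m))
    (F : seq 'I_m -> V) :
    {subset D <= permutations (enum 'I_m)} ->
  \sum_(a : 'S_m) F (word a) *+ count_mem (word a) D = \sum_(w <- D) F w.
Proof.
move=> sD; rewrite (sum_word (fun w => F w *+ count_mem w D)).
rewrite (bigID (mem D)) /= [X in _ + X]big1 ?addr0; last first.
  by move=> w /count_memPn ->; rewrite mulr0n.
rewrite -big_filter -[RHS]big_undup_iterop_count /=.
rewrite (perm_big (undup D)); last first.
  apply: uniq_perm; rewrite ?undup_uniq ?filter_uniq ?permutations_uniq // => w.
  by rewrite mem_filter mem_undup; case: (boolP (w \in D)) => //= /sD.
by [].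
Qed.

(** * Half sets and their stackings *)

Lemma perm_lexsort (m : nat) (l : seq (seq 'I_m)) : perm_eq (lexsort l) l.
Proof. by rewrite /lexsort perm_sort. Qed.

Lemma half_subsetsP (m : nat) (c : seq 'I_m) :
  reflect (exists2 C : {set 'I_m},
      [exists i in C, val i == 0%N] && (#|C| == m./2) & c = enum C)
    (c \in half_subsets m).
Proof.
rewrite (perm_mem (perm_lexsort _)).
by apply: (iffP imageP) => -[C hC ->]; exists C.
Qed.

Definition outside (m : nat) (c : seq 'I_m) : seq 'I_m :=
  [seq i <- enum 'I_m | i \notin c].

Lemma mem_outside (m : nat) (c : seq 'I_m) (i : 'I_m) :
  (i \in outside c) = (i \notin c).
Proof. by rewrite mem_filter mem_enum andbT. Qed.

Lemma half_subset_size (m : nat) (c : seq 'I_m) :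
  c \in half_subsets m -> size c = m./2.
Proof. by case/half_subsetsP => C /andP[_ /eqP <-] ->; rewrite cardE. Qed.

Lemma half_subset_cat (m : nat) (c : seq 'I_m) :
  c \in half_subsets m -> perm_eq (c ++ outside c) (enum 'I_m).
Proof.
case/half_subsetsP => C _ ->.
apply: uniq_perm; last 1 first.
- by move=> i; rewrite mem_cat mem_outside orbN mem_enum.
- rewrite cat_uniq enum_uniq filter_uniq ?enum_uniq // andbT /=.
  by apply/hasPn => i; rewrite mem_outside.
- exact: enum_uniq.
Qed.

Lemma size_outside (m : nat) (c : seq 'I_m) :
  ~~ odd m -> c \in half_subsets m -> size (outside c) = m./2.
Proof.
move=> m_even hc; apply: (@addnI m./2).
rewrite -{1}(half_subset_size hc) -size_cat (perm_size (half_subset_cat hc)).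
by rewrite size_enum_ord addnn even_halfK.
Qed.

(** Complementation exchanges the halves of size m/2 that contain the first
    label with those that do not. *)
Lemma size_half_subsets (m : nat) : (0 < m)%N -> ~~ odd m ->
  (size (half_subsets m)).*2 = 'C(m, m./2).
Proof.
case: m => // m _ m_even; rewrite (perm_size (perm_lexsort _)) size_image.
set s := m.+1./2.
pose A := [set C : {set 'I_m.+1} | (ord0 \in C) && (#|C| == s)].
have -> : #|[pred C : {set 'I_m.+1} |
    [exists i in C, val i == 0%N] & #|C| == s]| = #|A|.
  apply: eq_card => C; rewrite !inE; congr (_ && _).
  apply/existsP/idP => [[i /andP[iC /eqP i0]]|C0]; last first.
    by exists ord0; rewrite C0.
  by rewrite (_ : ord0 = i) //; apply: val_inj.
rewrite -[X in 'C(X, _)](card_ord m.+1) -card_draws -[RHS](cardsID A) -addnn.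
congr (_ + _)%N.
  by apply: eq_card => C; rewrite !inE andbA andbAC andbb andbC.
rewrite -(card_imset _ (can_inj (@setCK _))); apply: eq_card => C.
apply/imsetP/idP => [[B + ->]|]; rewrite !inE => /andP[].
  move=> B0 /eqP cB; rewrite B0 /=; apply/eqP/(@addnI s).
  by rewrite -{1}cB cardsC card_ord addnn even_halfK.
move=> nC /eqP cC; exists (~: C); last by rewrite setCK.
rewrite !inE; move: nC; rewrite cC eqxx andbT => ->.
by apply/eqP/(@addnI s); rewrite -{1}cC cardsC card_ord addnn even_halfK.
Qed.

(** The pairs (b, b') are kept apart from the words so that a block and the set
    of all words over a half set differ only in the list of pairs [s]. *)
Definition stacks (m : nat) (s : seq (seq 'I_m * seq 'I_m)) : seq (seq 'I_m) :=
  [seq bb.1 ++ bb.2 | bb <- s] ++ [seq rev bb.2 ++ bb.1 | bb <- s].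

Lemma block_stacks (m : nat) (c : seq 'I_m) :
  block c = stacks (zip (perm_array c) (perm_array (outside c))).
Proof.
rewrite /block /stacks /hcat /colrev -/(outside c); congr (_ ++ _).
elim: (perm_array c) (perm_array (outside c)) => [|b s IHs] [|b' t] //=.
by rewrite IHs.
Qed.

Definition all_stackings (m : nat) (c : seq 'I_m) : seq (seq 'I_m) :=
  stacks [seq (b, b') | b <- permutations c, b' <- permutations (outside c)].

Lemma stacks_perm (m : nat) (c : seq 'I_m) (s : seq (seq 'I_m * seq 'I_m)) :
    c \in half_subsets m ->
    (forall bb, bb \in s ->
       (bb.1 \in permutations c) && (bb.2 \in permutations (outside c))) ->
  {subset stacks s <= permutations (enum 'I_m)}.
Proof.
move=> hc hs w; rewrite mem_permutations mem_cat.
case/orP=> /mapP[[b b'] /hs + ->];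
  rewrite !mem_permutations /= => /andP[pb pb'];
  apply: perm_trans (half_subset_cat hc).
  exact: perm_cat.
by rewrite perm_catC perm_cat // perm_rev.
Qed.

Lemma mem_perm_zip (m : nat) (c d : seq 'I_m) bb :
    size (perm_array c) = size (perm_array d) ->
    bb \in zip (perm_array c) (perm_array d) ->
  (bb.1 \in permutations c) && (bb.2 \in permutations d).
Proof.
move=> sz hbb; have := map_f fst hbb; have := map_f snd hbb.
rewrite -/(unzip1 _) -/(unzip2 _) unzip1_zip ?sz // unzip2_zip ?sz //.
by rewrite !(perm_mem (perm_lexsort _)) => -> ->.
Qed.

Lemma size_perm_array (m : nat) (c : seq 'I_m) :
  uniq c -> size (perm_array c) = (size c)`!.
Proof.
by move=> uc; rewrite (perm_size (perm_lexsort _)) size_permutations.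
Qed.

Lemma half_subset_uniq (m : nat) (c : seq 'I_m) :
  c \in half_subsets m -> uniq (c ++ outside c).
Proof. by move/half_subset_cat/perm_uniq->; rewrite enum_uniq. Qed.

Lemma size_halves (m : nat) (c : seq 'I_m) :
  ~~ odd m -> c \in half_subsets m ->
  size (perm_array c) = (m./2)`! /\ size (perm_array (outside c)) = (m./2)`!.
Proof.
move=> m_even hc; have := half_subset_uniq hc; rewrite cat_uniq.
case/and3P=> uc _ ud.
by rewrite !size_perm_array // half_subset_size // size_outside.
Qed.

Lemma dstar_perm (m : nat) : ~~ odd m ->
  {subset dstar_array m <= permutations (enum 'I_m)}.
Proof.
move=> m_even w /flatten_mapP[c hc]; rewrite block_stacks.
apply: stacks_perm (hc) _ w => bb; apply: mem_perm_zip.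
by case: (size_halves m_even hc) => -> ->.
Qed.

Lemma size_stacks (m : nat) (s : seq (seq 'I_m * seq 'I_m)) :
  size (stacks s) = (size s).*2.
Proof. by rewrite size_cat !size_map addnn. Qed.

(** The cardinal of both sides of [all_stackings_perm]. *)
Lemma fact_halves (m : nat) : (0 < m)%N -> ~~ odd m ->
  (size (half_subsets m) * ((m./2)`! * (m./2)`!).*2)%N = m`!.
Proof.
move=> m_gt0 m_even; rewrite -doubleMr doubleMl size_half_subsets //.
have mh : (m./2 + m./2 = m)%N by rewrite addnn even_halfK.
have le_half : (m./2 <= m)%N by rewrite -{2}mh leq_addr.
have sub_half : (m - m./2 = m./2)%N by rewrite -{1}mh addnK.
by rewrite -[RHS](bin_fact le_half) sub_half.
Qed.

Lemma size_flatten_const (T U : eqType) (f : T -> seq U) (s : seq T) (n : nat) :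
  (forall c, c \in s -> size (f c) = n) ->
  size (flatten [seq f c | c <- s]) = (size s * n)%N.
Proof.
move=> h; rewrite size_flatten sumnE /shape -map_comp big_map big_seq.
by rewrite (eq_bigr (fun=> n)) // -big_seq big_const_seq count_predT iter_addn_0
  mulnC.
Qed.

Lemma size_dstar (m : nat) : (0 < m)%N -> ~~ odd m ->
  (size (dstar_array m) * (m./2)`!)%N = m`!.
Proof.
move=> m_gt0 m_even; rewrite -(fact_halves m_gt0 m_even).
rewrite (@size_flatten_const _ _ _ _ (m./2)`!.*2).
  by rewrite -mulnA -doubleMl.
move=> c hc; rewrite block_stacks size_stacks size_zip.
by case: (size_halves m_even hc) => -> ->; rewrite minnn.
Qed.

(** Cutting a word in the middle shows that every word is a stacking over the
    half that contains the first label.  As both lists have m! entries, this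
    surjectivity already forces the stackings to be pairwise distinct. *)
Lemma all_stackings_perm (m : nat) : (0 < m)%N -> ~~ odd m ->
  perm_eq (flatten [seq all_stackings c | c <- half_subsets m])
          (permutations (enum 'I_m)).
Proof.
move=> m_gt0 m_even; set D := flatten _; set E := permutations _.
have mh : (m./2 + m./2 = m)%N by rewrite addnn even_halfK.
have sDE : {subset D <= E}.
  move=> w /flatten_mapP[c hc]; apply: stacks_perm (hc) _ w => bb.
  by case/allpairsP => -[b b'] [/= hb hb' ->]; rewrite hb hb'.
have szD : size D = size E.
  rewrite size_permutations ?enum_uniq // size_enum_ord.
  rewrite -(fact_halves m_gt0 m_even).
  apply: size_flatten_const => c hc; rewrite size_stacks size_allpairs.
  case: (size_halves m_even hc); rewrite !(perm_size (perm_lexsort _)).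
  by move=> -> ->.
have sED : {subset E <= D}.
  case: m m_gt0 m_even mh @D @E sDE szD => // m _ m_even mh D E _ _ w.
  rewrite mem_permutations => pw.
  have uw : uniq w by rewrite (perm_uniq pw) enum_uniq.
  have w_all i : i \in w by rewrite (perm_mem pw) mem_enum.
  have sw : size w = m.+1 by rewrite (perm_size pw) size_enum_ord.
  pose u := take m.+1./2 w; pose v := drop m.+1./2 w.
  have wE : w = u ++ v by rewrite cat_take_drop.
  have su : size u = m.+1./2.
    by rewrite size_takel // sw -{2}mh leq_addr.
  have sv : size v = m.+1./2 by rewrite size_drop sw -{1}mh addnK.
  have /and3P[uu /hasPn nuv uv] : [&& uniq u, ~~ has (mem u) v & uniq v].
    by rewrite -cat_uniq -wE.
  have half t : uniq t -> size t = m.+1./2 -> ord0 \in t ->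
      (enum [set i in t] \in half_subsets m.+1) /\
      t \in permutations (enum [set i in t]).
    move=> ut st t0; split.
      apply/half_subsetsP; exists [set i in t] => //.
      apply/andP; split; first by apply/existsP; exists ord0; rewrite inE t0.
      by rewrite cardsE -st; apply/eqP/card_uniqP.
    rewrite mem_permutations; apply: uniq_perm => //; first exact: enum_uniq.
    by move=> i; rewrite mem_enum inE.
  have other t t' : uniq t' -> (forall i, (i \in t') = (i \notin t)) ->
      t' \in permutations (outside (enum [set i in t])).
    move=> ut' h; rewrite mem_permutations; apply: uniq_perm => //.
      by rewrite filter_uniq // enum_uniq.
    by move=> i; rewrite mem_outside mem_enum inE h.
  have inv i : (i \in v) = (i \notin u).
    apply/idP/idP; first exact: nuv.
    by have := w_all i; rewrite wE mem_cat => /orP[->|].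
  case: (boolP (ord0 \in u)) => u0.
    have [hc pu] := half u uu su u0.
    apply/flatten_mapP; exists (enum [set i in u]) => //.
    rewrite mem_cat; apply/orP; left; apply/mapP; exists (u, v); last by [].
    by apply/allpairsP; exists (u, v); split; rewrite //=; exact: other.
  have [hc pv] := half v uv sv (etrans (inv _) u0).
  apply/flatten_mapP; exists (enum [set i in v]) => //.
  rewrite mem_cat; apply/orP; right; apply/mapP; exists (v, rev u).
    apply/allpairsP; exists (v, rev u); split; rewrite //=; apply: other.
      by rewrite rev_uniq.
    by move=> i; rewrite mem_rev inv negbK.
  by rewrite /= revK.
have uE : uniq E by exact: permutations_uniq.
apply: uniq_perm => //.
  by apply: (leq_size_uniq uE sED); rewrite szD.
by move=> w; apply/idP/idP; [exact: sDE | exact: sED].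
Qed.

(** * Parity of the coordinates of x on the two words of a pair *)

Lemma index_rev (T : eqType) (s : seq T) (i : T) :
  uniq s -> i \in s -> index i (rev s) = (size s - (index i s).+1)%N.
Proof.
move=> us hi; have hs : (index i s < size s)%N by rewrite index_mem.
have hr : (size s - (index i s).+1 < size s)%N by rewrite subnSK // leq_subr.
have := @index_uniq _ i _ (rev s); rewrite size_rev rev_uniq => /(_ _ hr us).
by rewrite nth_rev // subnSK // subKn ?nth_index // ltnW.
Qed.

Lemma zword_rev (R : realType) (m : nat) (w : seq 'I_m) (ij : 'I_m * 'I_m) :
    uniq w -> ij.1 \in w -> ij.2 \in w -> ij.1 != ij.2 ->
  zword R (rev w) ij = - zword R w ij.
Proof.
case: ij => i j /= uw iw jw nij; rewrite /zword /=.
rewrite !index_rev // ltn_sub2lE ?ltnS; last first.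
  by rewrite index_mem.
have : index i w != index j w.
  by apply: contraNneq nij => /(congr1 (nth i w)); rewrite !nth_index // => ->.
by case: (ltngtP (index i w) (index j w)) => // _ _; rewrite ?opprK.
Qed.

(** Even and odd refer to the exchange of the two words built from the same
    (b, b').  The parity also determines which of b, b' the value depends on,
    and this coincidence is what makes [stack_prod] true. *)
Definition stack_even (R : realType) (m : nat) (c : seq 'I_m)
    (f : seq 'I_m -> R) : Prop :=
  exists g : seq 'I_m -> R, forall b b',
    b \in permutations c -> b' \in permutations (outside c) ->
    f (b ++ b') = g b /\ f (rev b' ++ b) = g b.

Definition stack_odd (R : realType) (m : nat) (c : seq 'I_m)
    (f : seq 'I_m -> R) : Prop :=
  exists g : seq 'I_m -> R, forall b b',
    b \in permutations c -> b' \in permutations (outside c) ->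
    f (b ++ b') = g b' /\ f (rev b' ++ b) = - g b'.

(** Of the four positions of i and j relative to c, only both in c gives an
    even coordinate.  When c separates i from j, the coordinate is constant over
    all words b b', with the opposite constant over all (reversed b') b. *)
Lemma zword_stack (R : realType) (m : nat) (c : seq 'I_m) (ij : 'I_m * 'I_m) :
    uniq c -> ij.1 != ij.2 ->
  stack_even c (fun w => zword R w ij) \/ stack_odd c (fun w => zword R w ij).
Proof.
move=> uc nij.
have memb b i : b \in permutations c -> (i \in b) = (i \in c).
  by rewrite mem_permutations => /perm_mem->.
have memb' b' i : b' \in permutations (outside c) -> (i \in b') = (i \notin c).
  by rewrite mem_permutations => /perm_mem->; rewrite mem_outside.
have ltc (T : eqType) (s : seq T) i k : i \in s -> (index i s < size s + k)%N.
  by move=> h; apply: leq_trans (leq_addr _ _); rewrite index_mem.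
have gtc (T : eqType) (s : seq T) i k :
    i \in s -> (size s + k < index i s)%N = false.
  by move=> h; apply/negbTE; rewrite -leqNgt ltnW // ltc.
case: ij nij => i j /= nij.
case: (boolP (i \in c)) => ic; case: (boolP (j \in c)) => jc.
- left; exists (fun b => zword R b (i, j)) => b b' hb hb'; split.
    by rewrite /zword /= !index_cat !(memb b) // ic jc.
  by rewrite /zword /= !index_cat !mem_rev !(memb' b') // ic jc /= ltn_add2l.
- right; exists (fun=> 1) => b b' hb hb'; split.
    by rewrite /zword /= !index_cat !(memb b) // ic (negbTE jc) ltc // (memb b).
  rewrite /zword /= !index_cat !mem_rev !(memb' b') // ic jc /=.
  by rewrite gtc // mem_rev (memb' b').
- right; exists (fun=> -1) => b b' hb hb'; split.
    by rewrite /zword /= !index_cat !(memb b) // jc (negbTE ic) gtc // (memb b).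
  rewrite /zword /= !index_cat !mem_rev !(memb' b') // ic jc /= opprK.
  by rewrite ltc // mem_rev (memb' b').
- right; exists (fun b' => zword R b' (i, j)) => b b' hb hb'; split.
    by rewrite /zword /= !index_cat !(memb b) // (negbTE ic) (negbTE jc)
      ltn_add2l.
  rewrite -zword_rev ?(memb' b') //; last first.
    move: hb'; rewrite mem_permutations => /perm_uniq->.
    by rewrite filter_uniq // enum_uniq.
  by rewrite /zword /= !index_cat !mem_rev !(memb' b') // ic jc.
Qed.

Lemma pairs_lt (m : nat) (ij : 'I_m * 'I_m) :
  (ij \in pairs m) = (ij.1 < ij.2)%N.
Proof.
apply/allpairsPdep/idP => [[i [j [_ + ->]]]|h].
  by rewrite mem_filter => /andP[].
exists ij.1, ij.2; rewrite mem_enum; split; last by case: ij h.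
  by [].
by rewrite mem_filter h mem_enum.
Qed.

(** The intercept is constant, hence even. *)
Lemma xword_stack (R : realType) (m : nat) (c : seq 'I_m) (k : 'I_(p m)) :
    uniq c ->
  stack_even c (fun w => xword R w k 0) \/ stack_odd c (fun w => xword R w k 0).
Proof.
move=> uc; case: (splitP k) => [i|i] ki.
  have -> : k = lshift (q m) i by apply: val_inj.
  by left; exists (fun=> 1) => b b' _ _; rewrite !col_mxEu !mxE.
pose ij := tnth (in_tuple (pairs m)) i.
have nij : ij.1 != ij.2.
  have : ij \in pairs m by exact: mem_tnth.
  by rewrite pairs_lt; apply: contraTneq => ->; rewrite ltnn.
have -> : k = rshift 1 i by apply: val_inj.
have xwordE w : xword R w (rshift 1 i) 0 = zword R w ij by rewrite col_mxEd mxE.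
by case: (zword_stack R uc nij) => -[g hg]; [left|right];
  exists g => b b' hb hb';
  rewrite !xwordE; exact: hg.
Qed.

(** A product of coordinates of different parities cancels between the two
    words, and one of equal parities involves b alone or b' alone. *)
Lemma stack_prod (R : realType) (m : nat) (c : seq 'I_m)
    (f1 f2 : seq 'I_m -> R) :
    stack_even c f1 \/ stack_odd c f1 -> stack_even c f2 \/ stack_odd c f2 ->
  exists g h : seq 'I_m -> R, forall b b',
    b \in permutations c -> b' \in permutations (outside c) ->
    f1 (b ++ b') * f2 (b ++ b') + f1 (rev b' ++ b) * f2 (rev b' ++ b)
    = g b + h b'.
Proof.
move=> [] [g1 h1] [] [g2 h2].
- exists (fun b => g1 b * g2 b *+ 2), (fun=> 0) => b b' hb hb'.
  by case: (h1 _ _ hb hb') (h2 _ _ hb hb') => -> -> [-> ->]; rewrite addr0.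
- exists (fun=> 0), (fun=> 0) => b b' hb hb'.
  by case: (h1 _ _ hb hb') (h2 _ _ hb hb') => -> -> [-> ->];
    rewrite mulrN subrr addr0.
- exists (fun=> 0), (fun=> 0) => b b' hb hb'.
  by case: (h1 _ _ hb hb') (h2 _ _ hb hb') => -> -> [-> ->];
    rewrite mulNr subrr addr0.
- exists (fun=> 0), (fun b' => g1 b' * g2 b' *+ 2) => b b' hb hb'.
  by case: (h1 _ _ hb hb') (h2 _ _ hb hb') => -> -> [-> ->];
    rewrite mulrNN add0r.
Qed.

(** Each entry of [s] occurs once in the zip and [size t] times in the product,
    and symmetrically for [t]; only the marginals matter to such summands. *)
Lemma sum_zip_additive (V : zmodType) (T U : Type) (s : seq T) (t : seq U)
    (g : T -> V) (h : U -> V) : size s = size t ->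
  (\sum_(bb <- zip s t) (g bb.1 + h bb.2)) *+ size s
  = \sum_(bb <- [seq (b, b') | b <- s, b' <- t]) (g bb.1 + h bb.2).
Proof.
move=> st; rewrite big_allpairs_dep /= big_split /= mulrnDl.
rewrite -(big_map fst predT g) -(big_map snd predT h) /=.
rewrite -/(unzip1 _) -/(unzip2 _) unzip1_zip ?st // unzip2_zip ?st //.
under [RHS]eq_bigr => b _ do
  rewrite big_split /= big_const_seq count_predT iter_addr_0.
by rewrite big_split /= sumrMnl big_const_seq count_predT iter_addr_0 st.
Qed.

Lemma sum_block (R : realType) (m : nat) (c : seq 'I_m)
    (f1 f2 : seq 'I_m -> R) :
    ~~ odd m -> c \in half_subsets m ->
    stack_even c f1 \/ stack_odd c f1 -> stack_even c f2 \/ stack_odd c f2 ->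
  (\sum_(w <- block c) f1 w * f2 w) *+ (m./2)`!
  = \sum_(w <- all_stackings c) f1 w * f2 w.
Proof.
move=> m_even hc hf1 hf2; have [g [h gh]] := stack_prod hf1 hf2.
have [sB sB'] := size_halves m_even hc.
have ss : size (perm_array c) = size (perm_array (outside c)) by rewrite sB sB'.
have E s : (forall bb, bb \in s ->
      (bb.1 \in permutations c) && (bb.2 \in permutations (outside c))) ->
    \sum_(w <- stacks s) f1 w * f2 w = \sum_(bb <- s) (g bb.1 + h bb.2).
  move=> hs; rewrite big_cat /= !big_map -big_split /=.
  rewrite big_seq [RHS]big_seq.
  by apply: eq_bigr => bb /hs/andP[]; exact: gh.
rewrite block_stacks !E; first last.
- by move=> bb; exact: mem_perm_zip.
- by move=> bb /allpairsP[[b b'] [/= hb hb' ->]]; rewrite hb hb'.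
rewrite -[in LHS]sB sum_zip_additive //; apply: perm_big.
by apply: perm_allpairs; exact: perm_lexsort.
Qed.

(** * The moment matrix of the design *)

Lemma sum_dstar (R : realType) (m : nat) (i j : 'I_(p m)) :
    (0 < m)%N -> ~~ odd m ->
  (\sum_(w <- dstar_array m) xword R w i 0 * xword R w j 0) *+ (m./2)`!
  = \sum_(a : 'S_m) x R a i 0 * x R a j 0.
Proof.
move=> m_gt0 m_even; under [RHS]eq_bigr => a _ do rewrite x_of_word.
rewrite (sum_word (fun w => xword R w i 0 * xword R w j 0)).
rewrite -(perm_big _ (all_stackings_perm m_gt0 m_even)).
rewrite !big_flatten !big_map /=.
rewrite -sumrMnl big_seq [RHS]big_seq; apply: eq_bigr => c hc.
have uc : uniq c.
  by have := half_subset_uniq hc; rewrite cat_uniq => /and3P[].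
by apply: sum_block => //; exact: xword_stack.
Qed.

Lemma design_dstar (m : nat) : (0 < m)%N -> ~~ odd m ->
  is_design (m`! %/ (m./2)`!) (dstar m).
Proof.
move=> m_gt0 m_even; rewrite -(size_dstar m_gt0 m_even) mulnK ?fact_gt0 //.
rewrite /is_design -sum1_size -(sum_count_word (fun=> 1%N) (dstar_perm m_even)).
by apply: eq_bigr => a _; rewrite -[LHS]natn.
Qed.

Lemma outerE (R : realType) (n : nat) (v : 'cV[R]_n) (i j : 'I_n) :
  (v *m v^T) i j = v i 0 * v j 0.
Proof. by rewrite mxE big_ord1 mxE. Qed.

Lemma moment_dstar (R : realType) (m : nat) : (0 < m)%N -> ~~ odd m ->
  moment R (m`! %/ (m./2)`!) (dstar m) = M0 R m.
Proof.
move=> m_gt0 m_even; rewrite -(size_dstar m_gt0 m_even) mulnK ?fact_gt0 //.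
apply/matrixP => i j; rewrite /moment /M0 mxE !summxE.
under [X in _ = _ * X]eq_bigr => a _ do rewrite outerE.
rewrite -sum_dstar // -(size_dstar m_gt0 m_even) natrM invfM.
rewrite mulrnAr -mulrnAl -[X in X * _]mulr_natr divfK; last first.
  by rewrite pnatr_eq0 -lt0n fact_gt0.
rewrite -(sum_count_word (fun w => xword R w i 0 * xword R w j 0)
  (dstar_perm m_even)).
rewrite mulr_sumr; apply: eq_bigr => a _.
rewrite mxE outerE -x_of_word -[_ *+ count_mem _ _]mulr_natl mulrA.
by congr (_ * _); rewrite mulrC.
Qed.

(** * Relabellings act by signed permutation matrices *)

Definition signed_fun_mx (R : realType) (n : nat) (f : 'I_n -> 'I_n)
    (e : 'I_n -> bool) : 'M[R]_n :=
  \matrix_(l, k) (if l == f k then (-1) ^+ e k else 0).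

Lemma signed_fun_mxP (R : realType) (n : nat) (f : 'I_n -> 'I_n)
    (e : 'I_n -> bool) : injective f -> signed_perm_mx (signed_fun_mx R f e).
Proof.
move=> f_inj.
have nz l k : (signed_fun_mx R f e l k != 0) = (l == f k).
  by rewrite mxE; case: (l == f k); rewrite ?signr_eq0 ?eqxx.
split=> [l|k|l k].
- exists ((perm f_inj)^-1%g l); split.
    by rewrite nz -(permE f_inj) permKV.
  by move=> k; rewrite nz -(permE f_inj) => /eqP->; rewrite permK.
- by exists (f k); split=> [|l]; rewrite nz // => /eqP.
- by rewrite nz mxE => ->; case: (e k); [right|left].
Qed.

Lemma signed_fun_mx_mul (R : realType) (n : nat) (f : 'I_n -> 'I_n)
    (e : 'I_n -> bool) (v : 'cV[R]_n) (k : 'I_n) :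
  ((signed_fun_mx R f e)^T *m v) k 0 = (-1) ^+ e k * v (f k) 0.
Proof.
rewrite mxE (bigD1 (f k)) //= !mxE eqxx big1 ?addr0 // => l /negbTE nl.
by rewrite !mxE nl mul0r.
Qed.

Definition pair_image (m : nat) (h : 'S_m) (ij : 'I_m * 'I_m) : 'I_m * 'I_m :=
  if (h ij.1 < h ij.2)%N then (h ij.1, h ij.2) else (h ij.2, h ij.1).

Lemma pair_image_lt (m : nat) (h : 'S_m) (ij : 'I_m * 'I_m) :
  ij \in pairs m -> pair_image h ij \in pairs m.
Proof.
rewrite !pairs_lt /pair_image => lt_ij; case: (ltnP (h ij.1)) => //= le_h.
rewrite ltn_neqAle le_h andbT; apply: contraTneq lt_ij => /val_inj/perm_inj->.
by rewrite ltnn.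
Qed.

Lemma pair_image_inj (m : nat) (h : 'S_m) :
  {in pairs m &, injective (pair_image h)}.
Proof.
move=> [i j] [k l]; rewrite !pairs_lt /pair_image /= => ij kl.
by do 2 case: ifP => _; move=> [/perm_inj e1 /perm_inj e2];
  move: ij kl; rewrite ?e1 ?e2 // => ij /(ltn_trans ij); rewrite ltnn.
Qed.

(** The label i stands in a * h^-1 where h i stands in a. *)
Lemma zval_relabel (R : realType) (m : nat) (a h : 'S_m) (ij : 'I_m * 'I_m) :
    ij \in pairs m ->
  zval R (a * h^-1)%g ij
  = (-1) ^+ (h ij.2 < h ij.1)%N * zval R a (pair_image h ij).
Proof.
case: ij => i j; rewrite pairs_lt /= => lt_ij.
have nij : i != j by apply: contraTneq lt_ij => ->; rewrite ltnn.
rewrite /zval /precedes /pair_image /= invMg invgK !permM.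
have na : (a^-1)%g (h i) != (a^-1)%g (h j) :> nat.
  by apply: contra nij => /eqP/val_inj/perm_inj/perm_inj->.
have nh : h i != h j :> nat by apply: contra nij => /eqP/val_inj/perm_inj->.
by case: (ltngtP (h i) (h j)) nh => //= _ _; move: na; case: ltngtP => //= _ _;
  rewrite ?expr0 ?expr1 ?mul1r ?mulrN1 ?mulN1r ?opprK.
Qed.

Lemma pairs_uniq (m : nat) : uniq (pairs m).
Proof.
apply: allpairs_uniq_dep => [||[i j] [k l] _ _ [-> ->]] //.
  exact: enum_uniq.
by move=> i _; rewrite filter_uniq // enum_uniq.
Qed.

(** The coordinates of x are permuted by [pair_image h], the intercept being
    fixed, and the sign records the pairs whose order h reverses. *)
Lemma relabel_signed_perm (R : realType) (m : nat) (h : 'S_m) :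
  exists2 P : 'M[R]_(p m), signed_perm_mx P &
    forall a, x R (a * h^-1)%g = P^T *m x R a.
Proof.
pose t := in_tuple (pairs m).
have tP k : tnth t k \in pairs m by exact: mem_tnth.
have t_inj : injective (tnth t) by apply/tuple_uniqP; exact: pairs_uniq.
have /fin_all_exists[f fE] k : exists l, tnth t l = pair_image h (tnth t k).
  by have /(tnthP t)[l ->] := pair_image_lt h (tP k); exists l.
have f_inj : injective f.
  by move=> k l /(congr1 (tnth t)); rewrite !fE => /pair_image_inj/t_inj->.
pose F (k : 'I_(p m)) : 'I_(p m) :=
  match split k with inl i => lshift (q m) i | inr i => rshift 1 (f i) end.
pose e (k : 'I_(p m)) :=
  match split k with
  | inl _ => false
  | inr i => (h (tnth t i).2 < h (tnth t i).1)%N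
  end.
have F_inj : injective F.
  move=> k l; rewrite /F -{2}(splitK k) -{2}(splitK l).
  case: (split k) (split l) => [i|i] [j|j] /=.
  - by move/lshift_inj->.
  - by move/eqP; rewrite eq_lrshift.
  - by move/eqP; rewrite eq_rlshift.
  - by move/rshift_inj/f_inj->.
exists (signed_fun_mx R F e) => [|a]; first exact: signed_fun_mxP.
apply/colP => k; rewrite signed_fun_mx_mul /F /e -{1}(splitK k).
case: (split k) => i /=; first by rewrite !col_mxEu !mxE expr0 mulr1.
by rewrite !col_mxEd !mxE zval_relabel // fE.
Qed.

(** * Concavity and optimality *)

Lemma nnd_moment (R : realType) (m N : nat) (r : 'S_m -> nat) :
  nnd (moment R N r).
Proof.
split=> [|v].
  rewrite /moment linear_sum; apply: eq_bigr => a _.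
  by rewrite linearZ /= trmx_mul trmxK.
rewrite /moment mulmx_sumr mulmx_suml summxE; apply: sumr_ge0 => a _.
rewrite -scalemxAr -scalemxAl mxE mulr_ge0 ?divr_ge0 ?ler0n //.
have -> : v^T *m (x R a *m (x R a)^T) *m v
    = ((x R a)^T *m v)^T *m ((x R a)^T *m v).
  by rewrite trmx_mul trmxK !mulmxA.
by rewrite mxE big_ord1 mxE -expr2 sqr_ge0.
Qed.

Lemma nnd_congr (R : realType) (n : nat) (M P : 'M[R]_n) :
  nnd M -> nnd (P^T *m M *m P).
Proof.
move=> [sM pM]; split=> [|v]; first by rewrite !trmx_mul trmxK sM mulmxA.
by have := pM (P *m v); rewrite trmx_mul !mulmxA.
Qed.

Lemma nnd_convex (R : realType) (n : nat) (M1 M2 : 'M[R]_n) (t : R) :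
  nnd M1 -> nnd M2 -> 0 < t < 1 -> nnd (t *: M1 + (1 - t) *: M2).
Proof.
move=> [s1 p1] [s2 p2] /andP[t0 t1]; split=> [|v].
  by rewrite linearD !linearZ /= s1 s2.
rewrite mulmxDr mulmxDl -!scalemxAr -!scalemxAl.
rewrite mxE [X in X + _]mxE [X in _ + X]mxE.
by rewrite addr_ge0 // mulr_ge0 // ?p1 ?p2 ?subr_ge0 ltW.
Qed.

Lemma convex_mean (R : realType) (V : lmodType R) (K : V -> Prop)
    (I : Type) (i : I) (s : seq I) (F : I -> V) :
    (forall u v t, K u -> K v -> 0 < t < 1 -> K (t *: u + (1 - t) *: v)) ->
    (forall j, K (F j)) ->
  K ((size (i :: s))%:R^-1 *: \sum_(j <- i :: s) F j).
Proof.
move=> K_convex KF; elim: s i => [|j s IHs] i.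
  by rewrite big_seq1 invr1 scale1r.
set n := size (j :: s).
have n0 : n%:R != 0 :> R by rewrite pnatr_eq0.
have t01 : 0 < (n.+1%:R : R)^-1 < 1.
  by rewrite invr_gt0 ltr0n invf_lt1 ?ltr0n // ltr1n.
have := K_convex _ _ _ (KF i) (IHs j) t01; congr K.
rewrite [in RHS]big_cons [RHS]scalerDr scalerA; congr (_ + _ *: _).
have nS : n.+1%:R != 0 :> R by rewrite pnatr_eq0.
apply: (mulIf n0); rewrite mulfVK //; apply: (mulfI nS).
by rewrite mulrBr mulr1 mulfV // mulVKf // -natr1 addrK.
Qed.

(** Superlevel sets reduce Jensen's inequality to the convexity of a set, so
    that no long weighted sum of extended reals has to be handled. *)
Lemma superlevel_convex (R : realType) (n : nat) (phi : 'M[R]_n -> \bar R)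
    (c : \bar R) (M1 M2 : 'M[R]_n) (t : R) :
    concave phi -> c != +oo%E -> nnd M1 -> nnd M2 ->
    (c <= phi M1)%E -> (c <= phi M2)%E -> 0 < t < 1 ->
  (c <= phi (t *: M1 + (1 - t) *: M2)%R)%E.
Proof.
move=> phi_c cfin n1 n2 h1 h2 t01; have /andP[t0 t1] := t01.
case: c cfin h1 h2 => [c _ h1 h2|//|_ _ _]; last exact: leNye.
apply: le_trans (phi_c _ _ _ n1 n2 t01).
have -> : c%:E = (t%:E * c%:E + (1 - t)%:E * c%:E)%E.
  by rewrite -!EFinM -EFinD -mulrDl addrC subrK mul1r.
by apply: leeD; apply: lee_wpmul2l; rewrite // lee_fin ?subr_ge0 ltW.
Qed.

(** For each treatment a, the relabellings a * h^-1 run once over all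
    treatments, so that a contributes M0 with weight r a / N. *)
Lemma mean_relabel (R : realType) (m N : nat) (r : 'S_m -> nat)
    (P : 'S_m -> 'M[R]_(p m)) : (0 < N)%N -> is_design N r ->
    (forall h a, x R (a * h^-1)%g = (P h)^T *m x R a) ->
  (m`!%:R)^-1 *: \sum_(h : 'S_m) ((P h)^T *m moment R N r *m P h) = M0 R m.
Proof.
move=> N_gt0 hr hP; rewrite /M0; congr (_ *: _).
have conj_outer h a : (P h)^T *m (x R a *m (x R a)^T) *m P h
    = x R (a * h^-1)%g *m (x R (a * h^-1)%g)^T.
  by rewrite hP trmx_mul trmxK !mulmxA.
under eq_bigr => h _.
  rewrite /moment mulmx_sumr mulmx_suml.
  under eq_bigr => a _ do rewrite -scalemxAr -scalemxAl conj_outer.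
  over.
rewrite exchange_big /=.
have sum_relabel a : \sum_(h : 'S_m) x R (a * h^-1)%g *m (x R (a * h^-1)%g)^T
    = \sum_(b : 'S_m) x R b *m (x R b)^T.
  by rewrite [RHS](reindex_inj (mulgI a)) [RHS](reindex_inj invg_inj).
under eq_bigr => a _ do rewrite -scaler_sumr sum_relabel.
rewrite -scaler_suml -mulr_suml -natr_sum hr mulfV ?scale1r //.
by rewrite pnatr_eq0 -lt0n.
Qed.

(** Jensen's inequality for the mean of [mean_relabel], over the convex set of
    nonnegative definite matrices where phi is at least its value at M. *)
Lemma le_phi_M0 (R : realType) (m N : nat) (r : 'S_m -> nat)
    (phi : 'M[R]_(p m) -> \bar R) : (0 < N)%N -> is_design N r ->
    criterion phi -> concave phi -> signed_perm_invariant phi ->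
  (phi (moment R N r) <= phi (M0 R m))%E.
Proof.
move=> N_gt0 hr phi_fin phi_c phi_inv; set M := moment R N r.
have nM : nnd M by exact: nnd_moment.
have /fin_all_exists2[P sP hP] := relabel_signed_perm R (m := m).
pose K (M' : 'M[R]_(p m)) := nnd M' /\ (phi M <= phi M')%E.
have KP h : K ((P h)^T *m M *m P h).
  by split; [exact: nnd_congr | rewrite phi_inv].
rewrite -(mean_relabel N_gt0 hr hP).
have K_convex u v t : K u -> K v -> 0 < t < 1 -> K (t *: u + (1 - t) *: v).
  move=> [nu hu] [nv hv] t01; split; first exact: nnd_convex.
  by apply: superlevel_convex => //; apply/eqP; exact: phi_fin.
have sz : size (enum 'S_m) = m`! by rewrite -cardT card_Sn.
have : enum 'S_m != [::] by rewrite -size_eq0 sz -lt0n fact_gt0.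
case E : (enum 'S_m) => [//|h s] _.
have [_] := convex_mean h s K_convex KP.
by rewrite -E sz big_enum.
Qed.

Theorem theorem3 (R : realType) (m : nat) (hm : (4 <= m)%N) (heven : ~~ odd m) :
  [/\ is_design (m`! %/ (m./2)`!) (dstar m),
      moment R (m`! %/ (m./2)`!) (dstar m) = M0 R m &
      forall phi : 'M[R]_(p m) -> \bar R,
        criterion phi -> concave phi -> signed_perm_invariant phi ->
        optimal (m`! %/ (m./2)`!) phi (dstar m)].
Proof.
have m_gt0 : (0 < m)%N by exact: leq_trans hm.
have hd := design_dstar m_gt0 heven.
split=> //; first exact: moment_dstar.
move=> phi phi_fin phi_c phi_inv; split=> // r hr.
rewrite moment_dstar //; apply: le_phi_M0 => //.
have := fact_gt0 m; rewrite -(size_dstar m_gt0 heven) mulnK ?fact_gt0 //.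
by rewrite muln_gt0 => /andP[].
Qed.
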